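(* Let $G=(V,E)$ be a connected $n$-vertex graph and let $\mathcal{H}^0=(\mathcal{C},E(\mathcal{H}^0))$ be a base hierarchy of $G$ (as defined in the context). Let $f\ge 1$ be an integer. There exists a partition $(S_1,\ldots,S_{f+1})$ of $V$ such that each $S\in\{S_1,\ldots,S_{f+1}\}$ is associated with a hierarchy $\mathcal{H}(S)$ of components $\mathcal{K}(S)$ that partition $V$, and the following hold. 1. $\mathcal{H}=\mathcal{H}(S)=(\mathcal{K}(S),E(\mathcal{H}(S)))$ is a coarsening of $\mathcal{H}^0$: $\mathcal{K}(S)$ is obtained by unifying connected subtrees of $\mathcal{H}^0$. $\mathcal{H}$ inherits the following properties of $\mathcal{H}^0$: (a) $\mathcal{H}$ has height at most $\log n$; (b) if $\{u,v\}\in E$ and $K_u,K_v\in\mathcal{K}(S)$ are the components containing $u,v$, then $K_u\prec K_v$ or $K_v\preceq K_u$; (c) for each $K\in\mathcal{K}(S)$, the subgraph of $G$ induced by $V(\mathcal{H}_K)=\bigcup_{K'\preceq K}K'$ is connected, and if $K'$ is a child of $K$ then $E\cap(K\times V(\mathcal{H}_{K'}))\ne\emptyset$. 2. Each $K\in\mathcal{K}(S)$ has a spanning tree $T(K)$ in the subgraph of $G$ induced by $K$. All vertices in $K-S$ have degree at most $3\log n$ in $T(K)$, whereas vertices of $S$ can have arbitrarily large degree. 3. For $K\in\mathcal{K}(S)$, let $N(\mathcal{H}_K)$ be the set of vertices in $V-V(\mathcal{H}_K)$ that are adjacent in $G$ to some vertex in $V(\mathcal{H}_K)$. Then $|N(\mathcal{H}_K)|=O(f\log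 n)$.
   Context: Logarithms are base 2. For a rooted tree whose nodes are the classes of a partition of $V$, $\gamma\prec\gamma'$ means that $\gamma$ is a strict descendant of $\gamma'$, and $\preceq$ means $\prec$ or $=$. A base hierarchy of $G$ is a partition $\mathcal{C}$ of $V$ together with a rooted tree $\mathcal{H}^0=(\mathcal{C},E(\mathcal{H}^0))$ such that: (1) $\mathcal{H}^0$ has height at most $\log n$. (2) If $\{u,v\}\in E$ and $\gamma_u,\gamma_v\in\mathcal{C}$ are the parts containing $u,v$, then $\gamma_u\prec\gamma_v$ or $\gamma_v\preceq\gamma_u$. (3) For every $\gamma\in\mathcal{C}$, the subgraph of $G$ induced by $V(\mathcal{H}^0_\gamma)=\bigcup_{\gamma'\preceq\gamma}\gamma'$ is connected; in particular, for every $\gamma\in\mathcal{C}$ and child $\gamma'$ of $\gamma$, $E\cap(\gamma\times V(\mathcal{H}^0_{\gamma'}))\neq\emptyset$. (4) Each $\gamma\in\mathcal{C}$ is spanned by a Steiner tree $T^0(\gamma)$, i.e. a tree that is a subgraph of $G$ containing all vertices of $\gamma$ (and possibly vertices not in $\gamma$), with maximum degree at most $4$; further, the maximum degree of the graph $T^\cup=\bigcup_{\gamma\in\mathcal{C}}T^0(\gamma)$ is at most $2\log n$. (It is known that every connected graph has a base hierarchy.) ''Unifying connected subtrees of $\mathcal{H}^0$'' means that the nodes of $\mathcal{H}^0$ are partitioned into sets each inducing a connected subtree of $\mathcal{H}^0$; each $K\in\mathcal{K}(S)$ is the union of the parts $\gamma$ in one such set, and $\mathcal{H}(S)$ is the rooted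 tree obtained from $\mathcal{H}^0$ by contracting each of these subtrees to one node. $\mathcal{H}_K$ is the subtree of $\mathcal{H}$ rooted at $K$. The classes $S_i$ of the partition may be empty. The $O(\cdot)$ constant is absolute. *)

(* Defs.v *)
From mathcomp Require Import all_boot all_order all_algebra.
From mathcomp Require Import reals exp.

Set Implicit Arguments.
Unset Strict Implicit.
Unset Printing Implicit Defensive.

Import Order.TTheory GRing.Theory Num.Theory.

Local Open Scope ring_scope.

Definition log2 (R : realType) (n : nat) : R := ln n%:R / ln 2%:R.

(* A graph whose vertices are taken in a finite type N; vset may be a proper
   subset of N, so that a subgraph lives in the same type as its ambient
   graph. *)
Record graph (N : finType) := Graph { vset : {set N}; adj : rel N }.

Definition simple_graph (N : finType) (G : graph N) : Prop :=
  [/\ symmetric (adj G), irreflexive (adj G) &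
      forall x y, adj G x y -> (x \in vset G) && (y \in vset G)].

Definition subgraph (N : finType) (H G : graph N) : Prop :=
  [/\ simple_graph H, vset H \subset vset G & subrel (adj H) (adj G)].

Definition induced (N : finType) (e : rel N) (A : {set N}) : graph N :=
  Graph A [rel x y | [&& x \in A, y \in A & e x y]].

Definition connected_graph (N : finType) (G : graph N) : Prop :=
  vset G != set0 /\ {in vset G &, forall x y, connect (adj G) x y}.

(* On a symmetric relation, [:: x; y] is a ucycle for every edge {x, y}; the
   genuine cycles are those of length at least 3. *)
Definition acyclic (N : finType) (G : graph N) : Prop :=
  forall s : seq N, ucycle (adj G) s -> (size s < 3)%N.

Definition tree (N : finType) (G : graph N) : Prop :=
  [/\ simple_graph G, connected_graph G & acyclic G].

Definition degree (N : finType) (t : rel N) (x : N) : nat := #|[set y | t x y]|.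

(* par H x y: x is a child of y. *)
Record rtree (N : finType) :=
  RTree { nodes : {set N}; root : N; par : rel N }.

Definition rooted_tree (N : finType) (H : rtree N) : Prop :=
  [/\ root H \in nodes H,
      forall x y, par H x y -> (x \in nodes H) && (y \in nodes H),
      forall y, ~~ par H (root H) y,
      forall x, x \in nodes H -> x != root H -> exists! y, par H x y
    & forall x, x \in nodes H -> connect (par H) x (root H)].

Definition desc_eq (N : finType) (H : rtree N) : rel N := connect (par H).

Definition desc (N : finType) (H : rtree N) : rel N :=
  [rel x y | (x != y) && desc_eq H x y].

(* The number of strict ancestors of x is the number of edges on the path from
   x to the root; a single node has height 0. *)
Definition height (N : finType) (H : rtree N) : nat :=
  \max_(x in nodes H) #|[set y in nodes H | desc H x y]|.

Section Hierarchies.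

Variables (R : realType) (V : finType) (e : rel V).

Implicit Types (H : rtree {set V}) (K : {set V}).

Definition Vsub H K : {set V} :=
  \bigcup_(K' in nodes H | desc_eq H K' K) K'.

Definition Nsub H K : {set V} :=
  [set v | (v \notin Vsub H K) && [exists u in Vsub H K, e u v]].

Definition hierarchy H : Prop :=
  partition (nodes H) [set: V] /\ rooted_tree H.

Definition log_height H : Prop := (height H)%:R <= log2 R #|V|.

Definition edges_comparable H : Prop :=
  forall u v, e u v ->
    let Ku := pblock (nodes H) u in
    let Kv := pblock (nodes H) v in
    desc H Ku Kv \/ desc_eq H Kv Ku.

Definition subtrees_connected H : Prop :=
  (forall K, K \in nodes H -> connected_graph (induced e (Vsub H K))) /\
  (forall K K', K \in nodes H -> par H K' K ->
     exists u v, [/\ u \in K, v \in Vsub H K' & e u v]).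

Definition steiner_trees H : Prop :=
  exists T0 : {set V} -> graph V,
    (forall g, g \in nodes H ->
       [/\ subgraph (T0 g) (Graph [set: V] e), tree (T0 g),
           g \subset vset (T0 g)
         & forall x, x \in vset (T0 g) -> (degree (adj (T0 g)) x <= 4)%N]) /\
    (forall x,
       (degree [rel u v | [exists g in nodes H, adj (T0 g) u v]] x)%:R
         <= 2%:R * log2 R #|V|).

Definition base_hierarchy H : Prop :=
  [/\ hierarchy H, log_height H, edges_comparable H, subtrees_connected H
    & steiner_trees H].

(* H is H0 with each block B of Q contracted to the node cover B. *)
Definition coarsening (H0 H : rtree {set V}) : Prop :=
  exists Q : {set {set {set V}}},
    [/\ partition Q (nodes H0),
        forall B, B \in Q ->
          connected_graph (induced [rel x y | par H0 x y || par H0 y x] B),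
        nodes H = [set cover B | B : {set {set V}} in Q],
        root H = cover (pblock Q (root H0))
      & forall K K',
          par H K K' <->
          exists B B' : {set {set V}},
            [/\ B \in Q /\ B' \in Q, K = cover B /\ K' = cover B', B != B'
              & exists g g', [/\ g \in B, g' \in B' & par H0 g g']]].

Definition spanning_tree_in (T : graph V) K : Prop :=
  [/\ subgraph T (induced e K), tree T & vset T = K].

End Hierarchies.

(* Main.v *)
(* Fix S. An auxiliary graph F, made of the union of the Steiner trees and of a
   set E of further edges of G, will have the components of the coarsening as
   its connected components. E may only grow as long as every v outside S has
   at most as many E-edges as there are strict ancestors, in the base
   hierarchy, of the node of v inside the F-component of v; this keeps its
   E-degree below the height, hence its F-degree below 3 log n.

   Take E with as many F-connected pairs as possible. If b is in S, a and b are
   adjacent and the node of b lies above the node of a, then a and b are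
   F-connected: otherwise the edge ab could be added, paid for by the new
   ancestor of a. Every F-component is moreover convex in the base hierarchy.
   Indeed, let a component X contain nodes below and above a node L which it
   misses. Follow a path from L to X inside the connected graph G[V(H_L)], and
   add the edges by which it leaves, for the last time, each component that it
   meets. A vertex receives at most one such edge on entering a component, paid
   for by the new ancestor L, and one on leaving it, paid for by the node of X
   above L.

   Convex components can be contracted. The subtree of a component K with top
   node t spans the same vertices as the subtree of t, and N(H_t) misses S: a
   neighbour in S would be F-connected to t and lie above it. Finally a union
   bound gives a colouring of V with f+1 colours such that every N(H_t) of more
   than 4 f log n vertices meets all colour classes. *)

Require Import Defs.
From mathcomp Require Import all_boot all_order all_algebra.
From mathcomp Require Import reals exp.

Set Implicit Arguments.
Unset Strict Implicit.
Unset Printing Implicit Defensive.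

Import Order.TTheory GRing.Theory Num.Theory.

Local Open Scope ring_scope.

(** * Spanning trees *)

(** A symmetric set of pairs that connects [K] and has least cardinality is acyclic: an edge of a
    cycle could be removed in both orientations, as the rest of the cycle joins its ends. *)
Lemma spanning_tree_exists (N : finType) (F : rel N) (K : {set N}) :
  symmetric F -> irreflexive F -> connected_graph (induced F K) ->
  exists2 T : graph N, subgraph T (induced F K) & tree T /\ vset T = K.
Proof.
move=> symF irrF [K0 connK].
pose ed (E : {set N * N}) : rel N := [rel x y | (x, y) \in E].
have edE E x y : ed E x y = ((x, y) \in E) by [].
pose good (E : {set N * N}) :=
  [&& [forall x, forall y, ((x, y) \in E) == ((y, x) \in E)],
      [forall x, forall y, ((x, y) \in E) ==> adj (induced F K) x y]
    & [forall x in K, forall y in K, connect (ed E) x y]].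
have good0 : good [set p | adj (induced F K) p.1 p.2].
  apply/and3P; split.
  - by apply/'forall_forallP => x y; rewrite !inE /= symF andbCA.
  - by apply/'forall_forallP => x y; rewrite !inE implybb.
  - apply/forall_inP => x xK; apply/forall_inP => y yK.
    apply: (connect_sub _ (connK x y xK yK)) => a b ab.
    by apply: connect1; rewrite edE inE.
case: (arg_minnP (fun E : {set N * N} => #|E|) good0) => E /and3P[sE fE cE] minE.
have {}sE x y : ((x, y) \in E) = ((y, x) \in E) by apply/eqP/(forallP (forallP sE x)).
have {}fE x y : (x, y) \in E -> [&& x \in K, y \in K & F x y].
  exact/implyP/(forallP (forallP fE x)).
have {}cE x y : x \in K -> y \in K -> connect (ed E) x y.
  by move=> xK; move: y; apply/forall_inP/(forall_inP cE).
exists (Graph K (ed E)); last split=> //.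
  split=> //.
  split=> [x y|x|x y /fE/and3P[-> ->]] //=; first exact: sE.
  by apply/negP => /fE; rewrite irrF !andbF.
split.
- split=> [x y|x|x y /fE/and3P[-> ->]] //=; first exact: sE.
  by apply/negP => /fE; rewrite irrF !andbF.
- by split=> // x y; apply: cE.
case=> [|x [|y [|z p]]] // /andP[/= /and3P[xy yz pth] /and3P[]].
rewrite !inE !negb_or => /and3P[x_y x_z x_p] /andP[y_z y_p] _; exfalso.
pose E' := E :\ (x, y) :\ (y, x).
have ltE : (#|E'| < #|E|)%N.
  apply: proper_card; apply/properP; split; first by apply/subsetP => u; rewrite !inE => /and3P[].
  by exists (x, y) => //; rewrite /E' !inE eqxx andbF.
suff /minE : good E' by rewrite leqNgt ltE.
have sE' a b : ((a, b) \in E') = ((b, a) \in E').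
  rewrite /E' !inE sE !xpair_eqE.
  by case: (a == x); case: (b == y); case: (a == y); case: (b == x).
(* The return path begins with the edge from [y] to [z], where [z] is not [x], and never meets [y]
   again, so it avoids the deleted edge. *)
have cxy : connect (ed E') y x.
  apply/connectP; exists (z :: rcons p x); last by rewrite /= last_rcons.
  apply/andP; split.
    rewrite edE /E' !inE -edE yz !xpair_eqE (eq_sym y) (negPf x_y) eqxx (eq_sym z) (negPf x_z).
    by rewrite !andbF.
  apply: (sub_in_path (P := [pred u | u != y]) _ _ pth).
    move=> a b; rewrite !edE /E' !inE !xpair_eqE => a_y b_y ->.
    by rewrite (negPf a_y) (negPf b_y) !andbF.
  rewrite /= eq_sym y_z all_rcons /= x_y; apply/allP => u up /=.
  by apply: contraNneq y_p => <-.
have csE' : connect_sym (ed E') by apply: sym_connect_sym => a b; apply: sE'.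
apply/and3P; split.
- by apply/'forall_forallP => a b; rewrite -sE'.
- apply/'forall_forallP => a b; apply/implyP; rewrite /E' !inE => /and3P[_ _]; apply: fE.
apply/forall_inP => a aK; apply/forall_inP => b bK.
apply: (connect_sub _ (cE a b aK bK)) => u v /= uv.
have [/eqP[-> ->]|n1] := boolP ((u, v) == (x, y)); first by rewrite csE'.
have [/eqP[-> ->]|n2] := boolP ((u, v) == (y, x)); first by [].
by apply: connect1; rewrite edE /E' !inE n1 n2.
Qed.

(** * Counting colourings *)

(** Bernoulli's inequality [1 + k/f <= (1 + 1/f)^k], cleared of denominators. *)
Lemma bernoulli_expn (f k : nat) : (f ^ k * (f + k) <= f.+1 ^ k * f)%N.
Proof.
elim: k => [|k IHk]; first by rewrite addn0.
rewrite !expnS -!mulnA; apply: leq_trans (leq_mul (leqnn f.+1) IHk).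
rewrite mulnCA [leqRHS]mulnCA leq_mul2l; apply/orP; right.
by rewrite addnS mulSn mulnS leq_add2r leq_addr.
Qed.

(** Bernoulli at [k = f] gives [2 f^f <= (f+1)^f], so every [f] factors contribute a factor 2. Hence
    at most a fraction [2^-j] of the colourings of [m] vertices avoid a given one of [f+1]
    colours. *)
Lemma expn_gap (f j m : nat) : (0 < f)%N -> (f * j <= m)%N ->
  (2 ^ j * f ^ m <= f.+1 ^ m)%N.
Proof.
move=> f0 /subnKC <-; rewrite !expnD mulnA.
apply: leq_mul; last first.
  by case: (m - f * j)%N => [|k]; rewrite ?expn0 // leq_exp2r.
have [->|j0] := posnP j; first by rewrite muln0.
rewrite !expnM -expnMn leq_exp2r //.
have := bernoulli_expn f f.
by rewrite addnn -muln2 (mulnC f 2) mulnA leq_pmul2r // mulnC.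
Qed.

(** Union bound: for each pair of a set and a colour, at most a fraction [2^-j] of all colourings
    miss that colour on that set, and there are fewer than [2^j] pairs. *)
Lemma hitting_colouring (V : finType) (A : {set {set V}}) (f j : nat) :
  (0 < f)%N -> (#|A| * f.+1 < 2 ^ j)%N ->
  (forall X, X \in A -> (f * j <= #|X|)%N) ->
  exists c : V -> 'I_f.+1, forall X k, X \in A -> exists2 v, v \in X & c v = k.
Proof.
move=> f0 ltA sizeA.
pose miss (p : {set V} * 'I_f.+1) : {set {ffun V -> 'I_f.+1}} :=
  [set c : {ffun V -> 'I_f.+1} | [forall v in p.1, c v != p.2]].
have card_miss X k : X \in A -> (2 ^ j * #|miss (X, k)| <= f.+1 ^ #|V|)%N.
  move=> XA.
  have -> : #|miss (X, k)| = (f ^ #|X| * f.+1 ^ #|~: X|)%N.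
    pose F v : pred 'I_f.+1 := if v \in X then predC1 k else predT.
    rewrite (_ : #|_| = #|family F|); last first.
      apply: eq_card => c; rewrite inE; apply/forall_inP/familyP => h v.
        rewrite /F; case: ifP => // vX; exact: h.
      by move=> vX; have := h v; rewrite /F vX.
    rewrite card_family foldrE big_map big_enum /=.
    rewrite (bigID [in X]) /=; congr muln.
      rewrite (eq_bigr (fun=> f)) ?prod_nat_const // => v vX.
      by rewrite /F vX cardC1 card_ord.
    rewrite (eq_bigr (fun=> f.+1)) => [|v vX].
      by rewrite prod_nat_const; congr (_ ^ _)%N; apply: eq_card => v; rewrite !inE.
    by rewrite /F (negPf vX) card_ord.
  rewrite mulnA -(cardsC X) expnD leq_mul2r; apply/orP; right.
  exact: expn_gap (sizeA _ XA).
have lt_miss : (#|\bigcup_(p in setX A setT) miss p| < f.+1 ^ #|V|)%N.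
  apply: (@leq_ltn_trans (\sum_(p in setX A setT) #|miss p|)).
    elim/big_rec2: _ => [|p m B _ leBm]; first by rewrite cards0.
    by apply: leq_trans (leq_card_setU _ _) _; rewrite leq_add2l.
  rewrite -(ltn_pmul2l (expn_gt0 2 j)) big_distrr /=.
  apply: (@leq_ltn_trans (\sum_(p in setX A [set: 'I_f.+1]) f.+1 ^ #|V|)).
    by apply: leq_sum => -[X k] /setXP[XA _]; apply: card_miss.
  rewrite sum_nat_const cardsX cardsT card_ord ltn_mul2r ltA andbT.
  by rewrite expn_gt0.
have [c cP] : exists c, c \notin \bigcup_(p in setX A setT) miss p.
  apply/existsP; apply: contraLR lt_miss; rewrite negb_exists -leqNgt => /forallP h.
  rewrite -{1}(card_ord f.+1) -card_ffun -cardsT; apply: subset_leq_card.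
  by apply/subsetP => c _; have := h c; rewrite negbK.
exists c => X k XA.
suff /exists_inP[v vX /eqP cv] : [exists v in X, c v == k] by exists v.
apply: contraNT cP => /exists_inPn h.
apply/bigcupP; exists (X, k); first by rewrite !inE XA.
by rewrite inE; apply/forall_inP => v vX; apply: h.
Qed.

(** * The ancestor order of a rooted tree *)

Section RootedTree.

Variables (N : finType) (H : rtree N).
Hypothesis rtH : rooted_tree H.

Lemma par_nodes x y : par H x y -> x \in nodes H /\ y \in nodes H.
Proof. by case: rtH => _ h _ _ _ /h/andP[]. Qed.

Lemma par_functional x y z : par H x y -> par H x z -> y = z.
Proof.
case: (rtH) => _ _ rootN uniqP _ xy xz.
have [xH _] := par_nodes xy.
have x_root : x != Defs.root H by apply: contraTneq xy => ->; apply: rootN.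
by have [w [_ uw]] := uniqP x xH x_root; rewrite -(uw y xy) (uw z xz).
Qed.

Lemma desc_eq_root x : x \in nodes H -> desc_eq H x (Defs.root H).
Proof. by case: rtH => _ _ _ _; apply. Qed.

Lemma desc_eq_rootl y : desc_eq H (Defs.root H) y -> y = Defs.root H.
Proof.
case: rtH => _ _ rootN _ _ /connectP[[|z p] /=]; first by [].
by rewrite (negPf (rootN z)).
Qed.

Lemma descP x y : desc H x y -> exists2 z, par H x z & desc_eq H z y.
Proof.
case/andP => x_y /connectP[[|z p] /=]; first by move=> _ eyx; rewrite eyx eqxx in x_y.
by case/andP => xz pth ->; exists z => //; apply/connectP; exists p.
Qed.

(** Since parents are unique, the upward paths from [x] to [y] and to [z] agree until one of them
    ends. *)
Lemma desc_eq_total x y z :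
  desc_eq H x y -> desc_eq H x z -> desc_eq H y z || desc_eq H z y.
Proof.
move=> /connectP[p]; elim: p x => [|w p IHp] x /=; first by move=> _ -> ->.
move=> /andP[xw pw] ly xz.
have [exz|x_z] := eqVneq x z.
  by apply/orP; right; apply/connectP; exists (w :: p); rewrite -exz //= xw.
have [|w' xw' wz] := @descP x z; first by rewrite /desc /= x_z.
by apply: (IHp w) => //; rewrite (par_functional xw xw').
Qed.

(** On an upward cycle through [x], uniqueness of parents would keep every ancestor of [x], the root
    included; but the root has no parent. *)
Lemma desc_eq_anti x y : desc_eq H x y -> desc_eq H y x -> x = y.
Proof.
move=> xy yx; apply/eqP; apply: contraTT isT => x_y.
have xH : x \in nodes H.
  have [|w xw _] := @descP x y; first by rewrite /desc /= x_y.
  by have [] := par_nodes xw.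
have above z : desc_eq H x z -> desc_eq H z x.
  move=> /connectP[p]; elim/last_ind: p z => [|p w IHp] z /=; first by move=> _ ->; apply: connect0.
  rewrite rcons_path last_rcons => /andP[pth lw] ->.
  set u := last x p in lw; have ux : desc_eq H u x by apply: IHp.
  have [t u_t ut] : exists2 t, u != t & desc_eq H u t /\ desc_eq H t x.
    case: (eqVneq u x) => [->|u_x]; first by exists y.
    by exists x => //; split=> //; apply: connect0.
  case: ut => ut tx; have [|w' uw' w't] := @descP u t; first by rewrite /desc /= u_t.
  by rewrite (par_functional lw uw'); apply: connect_trans tx.
have rx := above _ (desc_eq_root xH).
by move: x_y; rewrite (desc_eq_rootl rx) (desc_eq_rootl (connect_trans rx xy)) eqxx.
Qed.

Lemma desc_eq_desc x y z : desc_eq H x y -> desc H y z -> desc H x z.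
Proof.
move=> xy /andP[y_z yz]; rewrite /desc /= /desc_eq (connect_trans xy yz) andbT.
by apply: contraNneq y_z => exz; apply/eqP/desc_eq_anti => //; rewrite -exz.
Qed.

Lemma desc_eqVdesc x y : desc_eq H x y -> x = y \/ desc H x y.
Proof. by move=> xy; rewrite /desc /= xy andbT; case: eqVneq; [left|right]. Qed.

Lemma par_desc x y : par H x y -> desc H x y.
Proof.
move=> xy; rewrite /desc /= /desc_eq connect1 // andbT.
apply/eqP => exy; rewrite -{}exy in xy.
case: (rtH) => _ _ rootN _ _; have [xH _] := par_nodes xy.
suff ex : Defs.root H = x by have := rootN x; rewrite ex xy.
have /connectP[p] := desc_eq_root xH.
elim: p => [|z p IHp] //= /andP[xz]; rewrite -(par_functional xy xz).
exact: IHp.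
Qed.

End RootedTree.

(** * Contracting convex classes *)

Section Contraction.

Variables (V : finType) (e : rel V) (H0 : rtree {set V}).
Hypotheses (hH0 : hierarchy H0) (cmpH0 : edges_comparable e H0).

Notation nd := (pblock (nodes H0)).

Let rt0 : rooted_tree H0 := proj2 hH0.

Lemma mem_nd x : x \in nd x.
Proof. by case: hH0 => /and3P[/eqP cov _ _] _; rewrite mem_pblock cov inE. Qed.

Lemma nd_nodes x : nd x \in nodes H0.
Proof. by case: hH0 => /and3P[/eqP cov _ _] _; rewrite pblock_mem // cov inE. Qed.

Lemma nd_eq g x : g \in nodes H0 -> x \in g -> nd x = g.
Proof. by case: hH0 => /and3P[_ tI _] _; apply: def_pblock. Qed.

Lemma nodes_nd g : g \in nodes H0 -> exists x, g = nd x.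
Proof.
move=> gH; case: (set_0Vmem g) => [g0|[x xg]]; last by exists x; rewrite (nd_eq gH).
by case: hH0 => /and3P[_ _]; rewrite -g0 gH.
Qed.

Lemma in_Vsub v x : (v \in Vsub H0 (nd x)) = desc_eq H0 (nd v) (nd x).
Proof.
apply/bigcupP/idP => [[g /andP[gH gx] vg]|vx]; first by rewrite (nd_eq gH vg).
by exists (nd v); rewrite ?nd_nodes ?mem_nd.
Qed.

Lemma edge_comparable u v : e u v -> desc_eq H0 (nd u) (nd v) || desc_eq H0 (nd v) (nd u).
Proof. by move/cmpH0 => [/andP[_ ->]|->]; rewrite ?orbT. Qed.

(** The components of [F] will be contracted: [nodeF] makes them unions of nodes, and [convF] makes
    them convex along ancestor chains. *)
Variable F : rel V.
Hypotheses (symF : symmetric F) (subF : subrel F e).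
Hypothesis nodeF : forall x y, nd x = nd y -> connect F x y.
Hypothesis convF : forall x y z, connect F x z ->
  desc_eq H0 (nd x) (nd y) -> desc_eq H0 (nd y) (nd z) -> connect F x y.

Let csF : connect_sym F := sym_connect_sym symF.

Definition class_of x : {set V} := [set y | connect F x y].

Lemma mem_class x : x \in class_of x.
Proof. by rewrite inE connect0. Qed.

Lemma class_eqP x y : reflect (class_of x = class_of y) (connect F x y).
Proof.
apply: (iffP idP) => [xy|exy]; last by have := mem_class y; rewrite -exy inE.
by apply/setP => z; rewrite !inE; apply: same_connect.
Qed.

Lemma class_of_mem x y : y \in class_of x -> class_of y = class_of x.
Proof. by rewrite inE => xy; apply/esym/class_eqP. Qed.

(** Follow an [F]-path from [x]. A step down keeps the current bound; after a step up, the new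
    vertex and the bound are both above the previous vertex, hence comparable, and the higher one
    serves. *)
Lemma class_upper_bound x y : connect F x y ->
  exists z, [/\ connect F x z, desc_eq H0 (nd x) (nd z) & desc_eq H0 (nd y) (nd z)].
Proof.
move=> /connectP[p]; elim/last_ind: p y => [|p w IHp] y /=.
  by move=> _ ->; exists x; rewrite /desc_eq !connect0.
rewrite rcons_path last_rcons => /andP[pth lw] ->.
have [z [xz ndxz lz]] := IHp _ pth erefl.
have xl : connect F x (last x p) by apply/connectP; exists p.
have xw : connect F x w by apply: connect_trans (connect1 lw).
case/orP: (edge_comparable (subF lw)) => cmp; last first.
  by exists z; split=> //; apply: connect_trans cmp lz.
case/orP: (desc_eq_total rt0 cmp lz) => [wz|zw]; first by exists z.
by exists w; split=> //; [apply: connect_trans zw | apply: connect0].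
Qed.

(** Take [t] in the class with fewest ancestors: a common upper bound of [t] and [y] in the class
    cannot lie strictly above [t]. *)
Lemma class_top x : exists2 t, connect F x t &
  forall y, connect F x y -> desc_eq H0 (nd y) (nd t).
Proof.
pose up t := #|[set g | desc_eq H0 (nd t) g]|.
case: (@arg_minnP _ x (connect F x) up (connect0 _ _)) => t xt mint.
exists t => // y xy.
have ty : connect F t y by apply: connect_trans xy; rewrite csF.
have [z [tz ndtz yz]] := class_upper_bound ty.
have := mint z (connect_trans xt tz); rewrite leqNgt.
have [-> //|t_z] := eqVneq (nd t) (nd z).
case/negP; apply: proper_card; apply/properP; split.
  by apply/subsetP => g; rewrite !inE; apply: connect_trans.
exists (nd t); rewrite inE ?/desc_eq ?connect0 //.
by apply: contra t_z => zt; apply/eqP/(desc_eq_anti rt0).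
Qed.

Definition node_classes : {set {set {set V}}} :=
  [set [set g in nodes H0 | g \subset class_of x] | x : V].

(** The root has the form demanded by [coarsening]; [contraction_root] identifies it as a class. *)
Definition contraction : rtree {set V} :=
  RTree [set class_of x | x : V]
        (cover (pblock node_classes (Defs.root H0)))
        [rel K K' | [exists x, exists y,
           [&& K == class_of x, K' == class_of y, K != K' & par H0 (nd x) (nd y)]]].

Lemma class_nodes x : class_of x \in nodes contraction.
Proof. exact: imset_f. Qed.

Lemma sub_class y x : (nd y \subset class_of x) = connect F x y.
Proof.
apply/subsetP/idP => [/(_ y (mem_nd y))|xy z zy]; first by rewrite inE.
rewrite inE (connect_trans xy) //; apply: nodeF.
by rewrite (nd_eq (nd_nodes y) zy).
Qed.

Lemma cover_nodes_class x : cover [set g in nodes H0 | g \subset class_of x] = class_of x.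
Proof.
apply/setP => y; apply/bigcupP/idP => [[g]|xy].
  by rewrite inE => /andP[_ /subsetP]; apply.
by exists (nd y); rewrite ?mem_nd // inE nd_nodes sub_class; rewrite inE in xy.
Qed.

Lemma node_classes_partition : partition node_classes (nodes H0).
Proof.
apply/and3P; split.
- apply/eqP/setP => g; apply/bigcupP/idP => [[B /imsetP[x _ ->]]|gH].
    by rewrite inE => /andP[].
  have [x eg] := nodes_nd gH; rewrite eg.
  exists [set g in nodes H0 | g \subset class_of x]; first exact: imset_f.
  by rewrite inE nd_nodes sub_class connect0.
- apply/trivIsetP => B B' /imsetP[x _ ->] /imsetP[y _ ->] neq.
  apply/pred0P => g; apply/negP => /andP[]; rewrite !inE => /andP[gH].
  have [z ->] := nodes_nd gH; rewrite sub_class => xz /andP[_].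
  rewrite sub_class => yz; case/eqP: neq.
  have /class_eqP exy : connect F x y by apply: connect_trans xz _; rewrite csF.
  by rewrite exy.
- apply/imsetP => -[x _ /setP/(_ (nd x))].
  by rewrite !inE nd_nodes sub_class connect0.
Qed.

Lemma contraction_root x : nd x = Defs.root H0 -> Defs.root contraction = class_of x.
Proof.
move=> /= <-; rewrite -[RHS]cover_nodes_class; congr cover.
case/and3P: node_classes_partition => _ tI _.
apply: def_pblock => //; first exact: imset_f.
by rewrite inE nd_nodes sub_class connect0.
Qed.

Lemma par_contraction x y : connect F x y = false -> par H0 (nd x) (nd y) ->
  par contraction (class_of x) (class_of y).
Proof.
move=> xy pxy /=; apply/existsP; exists x; apply/existsP; exists y.
by rewrite !eqxx pxy andbT /=; apply/eqP => /class_eqP; rewrite xy.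
Qed.

(** An edge leaves a class only from its top node: otherwise the parent [y] would lie between [x]
    and the top, and convexity would put it in the class. Uniqueness of parents in the contraction
    rests on this. *)
Lemma contraction_parP K K' : par contraction K K' ->
  exists x y, [/\ K = class_of x, K' = class_of y, K != K', par H0 (nd x) (nd y)
     & forall z, connect F x z -> desc_eq H0 (nd z) (nd x)].
Proof.
move=> /= /existsP[x /existsP[y /and4P[/eqP-> /eqP-> neq pxy]]].
exists x, y; split=> // z xz; have [t xt topt] := class_top x.
have [-> |xt'] := desc_eqVdesc (topt x (connect0 _ _)); first exact: topt.
have [w pxw wt] := descP xt'; case/negP: neq; apply/eqP/class_eqP.
rewrite -(par_functional rt0 pxy pxw) in wt.
exact: convF xt (connect1 pxy) wt.
Qed.

Lemma desc_eq_contraction x y :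
  desc_eq H0 (nd x) (nd y) -> desc_eq contraction (class_of x) (class_of y).
Proof.
move=> /connectP[p]; elim: p x => [|g p IHp] x /=.
  by move=> _ /esym/nodeF/class_eqP->; apply: connect0.
move=> /andP[xg]; have [_ gH] := par_nodes rt0 xg.
have [z eg] := nodes_nd gH; rewrite eg in xg * => pth ly.
apply: connect_trans (IHp z pth ly).
case xz: (connect F x z); first by move/class_eqP: xz => ->; apply: connect0.
by apply/connect1/par_contraction.
Qed.

(** A converse to [desc_eq_contraction]. Each edge leaves a class from its top node, so a bound for
    the next class also bounds the present one. *)
Lemma contraction_desc_eqP x K : desc_eq contraction (class_of x) K ->
  exists2 y, K = class_of y & forall z, connect F x z -> desc_eq H0 (nd z) (nd y).
Proof.
move=> /connectP[p]; elim: p x => [|K1 p IHp] x.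
  move=> _ /= ->; have [t xt topt] := class_top x.
  by exists t; first exact/class_eqP.
move=> /andP[/contraction_parP[x' [y' [/class_eqP exx -> _ pxy topx]]] pth] lK.
have [y eK topy] := IHp y' pth lK; exists y => // z xz.
apply: (@connect_trans _ _ (nd x')).
  by apply: topx; apply: connect_trans xz; rewrite csF.
exact: connect_trans (connect1 pxy) (topy y' (connect0 _ _)).
Qed.

Lemma contraction_hierarchy : hierarchy contraction.
Proof.
have [r r0] : exists r, nd r = Defs.root H0.
  by case: rt0 => /nodes_nd[r ->] _ _ _ _; exists r.
split.
  apply/and3P; split.
  - apply/eqP/setP => x; rewrite inE; apply/bigcupP; exists (class_of x).
      exact: class_nodes.
    exact: mem_class.
  - apply/trivIsetP => K K' /imsetP[x _ ->] /imsetP[y _ ->] neq.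
    apply/pred0P => z; apply/negP => /andP[/class_of_mem ex /class_of_mem ey].
    by rewrite -ex ey eqxx in neq.
  - by apply/imsetP => -[x _ /setP/(_ x)]; rewrite mem_class inE.
have er := contraction_root r0.
(* The root class has no parent: a parent [y] of one of its nodes lies between that node and the
   root, so convexity applies. *)
have above_r x y : connect F r x -> par H0 (nd x) (nd y) -> connect F x y.
  move=> rx pxy; have [_ yH] := par_nodes rt0 pxy.
  apply: (convF (z := r)); rewrite 1?csF //; first exact: connect1.
  by rewrite r0; apply: desc_eq_root.
split.
- by rewrite er class_nodes.
- move=> K K' /contraction_parP[x [y [-> -> _ _ _]]].
  by rewrite !class_nodes.
- move=> K; rewrite er; apply/negP => /contraction_parP[x [y [/class_eqP rx eK neq pxy _]]].
  by case/eqP: neq; rewrite eK; apply/class_eqP; apply: connect_trans rx (above_r _ _ rx pxy).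
- move=> K /imsetP[x _ ->]; rewrite er => x_r.
  (* The parent of a class is the class of the parent of its top node. *)
  have [t xt topt] := class_top x.
  have t_r : nd t != Defs.root H0.
    apply: contraNneq x_r => tr; apply/eqP/class_eqP/(connect_trans xt)/nodeF.
    by rewrite tr r0.
  case: (rt0) => _ _ _ /(_ _ (nd_nodes t) t_r)[g [tg _]] _.
  have [_ /nodes_nd[y eg]] := par_nodes rt0 tg; rewrite {}eg in tg.
  have nty : connect F t y = false.
    apply: contraTF tg => ty; have yt := topt y (connect_trans xt ty).
    apply/negP => /[dup] tg /(par_desc rt0)/andP[/negP[]]; apply/eqP.
    by apply: (desc_eq_anti rt0) (connect1 tg) yt.
  have et : class_of x = class_of t by apply/class_eqP.
  exists (class_of y); split; first by rewrite et; apply: par_contraction.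
  move=> K1 /contraction_parP[x' [y' [/class_eqP xx' -> _ px' topx']]].
  have ett' : nd x' = nd t.
    apply: (desc_eq_anti rt0); first exact: topt.
    by apply: topx'; apply: connect_trans xt; rewrite csF.
  by apply/class_eqP/nodeF/(par_functional rt0 tg); rewrite -ett'.
- move=> K /imsetP[x _ ->]; rewrite er; apply: desc_eq_contraction.
  by rewrite r0; apply: desc_eq_root (nd_nodes x).
Qed.

Lemma in_class_pblock x : pblock (nodes contraction) x = class_of x.
Proof.
case: contraction_hierarchy => /and3P[_ tI _] _.
by apply: def_pblock (class_nodes x) (mem_class x).
Qed.

Lemma contraction_edges_comparable : edges_comparable e contraction.
Proof.
move=> u v uv; rewrite /= !in_class_pblock.
case/orP: (edge_comparable uv) => /desc_eq_contraction; last by right.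
by case/desc_eqVdesc => [->|]; [right; apply: connect0 | left].
Qed.

Lemma contraction_Vsub K : K \in nodes contraction ->
  exists t, [/\ K = class_of t, (forall y, connect F t y -> desc_eq H0 (nd y) (nd t))
    & Vsub contraction K = Vsub H0 (nd t)].
Proof.
move=> /imsetP[x _ ->]; have [t xt topt] := class_top x.
have ett y : connect F t y -> connect F x y by apply: connect_trans.
exists t; split; [exact/class_eqP | by move=> y /ett/topt |].
apply/setP => v; rewrite in_Vsub; apply/bigcupP/idP => [[K' /andP[/imsetP[y _ ->]]]|vt].
  move=> /contraction_desc_eqP[z /class_eqP xz ubz].
  by rewrite inE => /ubz vz; apply: connect_trans vz (topt z xz).
exists (class_of v); rewrite ?mem_class // class_nodes /=.
by move/class_eqP: xt => ->; apply: desc_eq_contraction.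
Qed.

Lemma contraction_subtrees_connected :
  subtrees_connected e H0 -> subtrees_connected e contraction.
Proof.
move=> [conn adjch]; split=> [K|K K'] KH.
  by have [t [_ _ ->]] := contraction_Vsub KH; apply: conn; apply: nd_nodes.
move=> /contraction_parP[x [y [eK' eK _ pxy topx]]].
have K'H : K' \in nodes contraction by rewrite eK' class_nodes.
have [t [eK't topt ->]] := contraction_Vsub K'H.
have /class_eqP xt : class_of x = class_of t by rewrite -eK'.
have -> : nd t = nd x.
  by apply: (desc_eq_anti rt0); [apply: topx | apply: topt; rewrite csF].
have [u [v [uy vx uv]]] := adjch _ _ (nd_nodes y) pxy.
exists u, v; split=> //; rewrite eK inE; apply: nodeF.
by rewrite (nd_eq (nd_nodes y) uy).
Qed.

Lemma contraction_height : (height contraction <= height H0)%N.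
Proof.
apply/bigmax_leqP => K /imsetP[x _ ->].
have [t xt topt] := class_top x.
pose A := [set g in nodes H0 | desc H0 (nd t) g].
apply: (@leq_trans #|A|).
  2: exact: (@leq_bigmax_cond _ [in nodes H0] _ (nd t) (nd_nodes t)).
(* On a node, [up] is the class containing it; it maps the strict ancestors of the top node onto a
   superset of those of the class. *)
pose up (g : {set V}) := \bigcup_(z in g) class_of z.
apply: (@leq_trans #|up @: A|); last exact: leq_imset_card.
apply: subset_leq_card; apply/subsetP => K'; rewrite inE => /andP[K'H /andP[neq]].
move=> /contraction_desc_eqP[y eK' uby]; apply/imsetP; exists (nd y).
  rewrite inE nd_nodes /desc /= (uby _ xt) andbT.
  apply: contraNneq neq => ety; rewrite eK'; apply/eqP/class_eqP.
  exact/(connect_trans xt)/nodeF.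
rewrite eK'; apply/setP => v; apply/idP/bigcupP => [yv|[z zy]].
  by exists y => //; apply: mem_nd.
have /class_eqP-> // : connect F y z by apply: nodeF; rewrite (nd_eq (nd_nodes y) zy).
Qed.

Lemma contraction_coarsening : coarsening H0 contraction.
Proof.
exists node_classes; split=> //.
- exact: node_classes_partition.
- move=> B /imsetP[x _ ->]; split.
    by apply/set0Pn; exists (nd x); rewrite /= inE nd_nodes sub_class connect0.
  set r := adj _.
  have symr : connect_sym r.
    by apply: sym_connect_sym => g g'; rewrite /r /= andbCA orbC.
  (* By convexity the upward path between two nodes of a class stays in the class, so every node is
     linked to the top one. *)
  have upr y z : connect F x y -> connect F x z -> desc_eq H0 (nd y) (nd z) ->
      connect r (nd y) (nd z).
    move=> xy xz /connectP[p]; elim: p y xy => [|g p IHp] y xy /=; first by move=> _ ->.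
    move=> /andP[yg]; have [_ /nodes_nd[w eg]] := par_nodes rt0 yg.
    rewrite {}eg in yg * => pth lz.
    have xw : connect F x w.
      apply: (connect_trans xy); apply: (convF (z := z)).
      - by apply: connect_trans xz; rewrite csF.
      - exact: connect1.
      - by rewrite lz; apply/connectP; exists p.
    apply: connect_trans (IHp w xw pth lz); apply: connect1.
    by rewrite /r /= !inE !nd_nodes !sub_class xy xw yg.
  move=> g g' /=; rewrite !inE => /andP[/nodes_nd[y ->]].
  rewrite sub_class => xy /andP[/nodes_nd[z ->]]; rewrite sub_class => xz.
  have [t xt topt] := class_top x.
  apply: (@connect_trans _ _ (nd t)); first by apply: upr => //; apply: topt.
  by rewrite symr; apply: upr => //; apply: topt.
- rewrite -imset_comp; apply: eq_imset => x /=; exact/esym/cover_nodes_class.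
move=> K K'; split.
  move=> /contraction_parP[x [y [-> -> neq pxy _]]].
  exists [set g in nodes H0 | g \subset class_of x],
         [set g in nodes H0 | g \subset class_of y]; split.
  - by split; apply: imset_f.
  - by rewrite !cover_nodes_class.
  - by apply: contra neq => /eqP exy; rewrite -[class_of x]cover_nodes_class exy cover_nodes_class.
  by exists (nd x), (nd y); rewrite !inE !nd_nodes !sub_class !connect0.
move=> [B [B' [[/imsetP[x _ ->] /imsetP[y _ ->]] [-> ->] neq [g [g' []]]]]].
rewrite !inE => /andP[/nodes_nd[x' ->]]; rewrite sub_class => xx'.
move=> /andP[/nodes_nd[y' ->]]; rewrite sub_class => yy' pxy.
rewrite !cover_nodes_class; move/class_eqP: (xx') => ->; move/class_eqP: (yy') => ->.
apply: par_contraction => //; apply: contraNF neq => xy.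
have /class_eqP-> // : connect F x y.
by apply: connect_trans xx' (connect_trans xy _); rewrite csF.
Qed.

End Contraction.

(** * Growing the set of joining edges *)

(** Here [a] is the last vertex of the path satisfying [P]. The strict decrease of the length drives
    the induction in [join_along_path]. *)
Lemma path_last_exit (T : eqType) (r : rel T) (P : pred T) q s :
  path r q s -> has P (q :: s) -> ~~ P (last q s) ->
  exists a b s', [/\ P a, a \in q :: s, r a b, path r b s'
    & [/\ all (predC P) (b :: s'), {subset b :: s' <= s}, last b s' = last q s
        & (size s' < size s)%N]].
Proof.
elim: s q => [|c s IHs] q; first by rewrite /= orbF => _ ->.
move=> /= /andP[qc pth] hasP lastP; have [hasP'|nP] := boolP (has P (c :: s)).
  have [a [b [s' [Pa ain ab pth' [allP sub lst sz]]]]] := IHs c pth hasP' lastP.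
  exists a, b, s'; split=> //; first by rewrite inE ain orbT.
  split=> //; last exact: ltnW.
  by move=> u /sub; rewrite inE orbC => ->.
have Pq : P q by move: hasP nP => /=; case: (P q) => //= ->.
rewrite -all_predC in nP; exists q, c, s; split=> //; first exact: mem_head.
by split.
Qed.

Section Growth.

Variables (V : finType) (e : rel V) (H0 : rtree {set V}) (S : {set V}) (TU : rel V).
Hypotheses (hH0 : hierarchy H0).
Hypothesis connH0 :
  forall g, g \in nodes H0 -> connected_graph (induced e (Vsub H0 g)).

Notation nd := (pblock (nodes H0)).

Hypothesis symTU : symmetric TU.
Hypothesis nodeTU : forall x y, nd x = nd y -> connect TU x y.

Implicit Types (E : {set V * V}).

Let rt0 : rooted_tree H0 := proj2 hH0.

Definition edge_rel (E : {set V * V}) : rel V :=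
  [rel x y | ((x, y) \in E) || ((y, x) \in E)].

Definition joined E : rel V := [rel x y | TU x y || edge_rel E x y].

Notation con E := (connect (joined E)).

(** Nodes are counted rather than vertices, so that the allowance never exceeds the height. *)
Definition joined_ancestors E v : {set {set V}} :=
  [set nd y | y in [set y | desc H0 (nd v) (nd y) && con E v y]].

Definition within (E : {set V * V}) := forall x y, (x, y) \in E -> e x y.

(* Vertices of [O] may exceed their allowance by one: they have been left
   through a new edge, but not yet connected to an ancestor paying for it. *)
Definition charged (E : {set V * V}) (O : {set V}) :=
  forall v, v \notin S ->
    (degree (edge_rel E) v <= #|joined_ancestors E v| + (v \in O))%N.

Lemma joined_sym E : symmetric (joined E).
Proof. by move=> x y; rewrite /joined /= symTU; congr (_ || _); apply: orbC. Qed.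

Lemma joined_csym E : connect_sym (joined E).
Proof. exact/sym_connect_sym/joined_sym. Qed.

Lemma joined_node E x y : nd x = nd y -> con E x y.
Proof.
move=> /nodeTU; apply: connect_sub => a b ab.
by apply: connect1; rewrite /joined /= ab.
Qed.

Lemma joined_mono E E' x y : E \subset E' -> con E x y -> con E' x y.
Proof.
move=> /subsetP sub; apply: connect_sub => a b ab; apply: connect1.
case/or3P: ab => [ab|/sub ab|/sub ab]; rewrite /joined /edge_rel /= ab ?orbT //.
Qed.

Lemma joined_ancestors_mono E E' v : E \subset E' ->
  joined_ancestors E v \subset joined_ancestors E' v.
Proof.
move=> sub; apply/imsetS/subsetP => y; rewrite !inE => /andP[-> /=].
exact: joined_mono.
Qed.

(** The node of [y] was not counted before through another vertex, since vertices of one node are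
    always connected. *)
Lemma joined_ancestors_gain E E' v y : E \subset E' -> desc H0 (nd v) (nd y) ->
  con E' v y -> ~~ con E v y -> (#|joined_ancestors E v| < #|joined_ancestors E' v|)%N.
Proof.
move=> sub vy cvy ncvy; apply: proper_card; apply/properP.
split; first exact: joined_ancestors_mono.
exists (nd y); first by apply: imset_f; rewrite inE vy.
apply: contra ncvy => /imsetP[z]; rewrite inE => /andP[_ vz] eyz.
by apply: (connect_trans vz); apply: joined_node.
Qed.

Lemma degree_add E q p v :
  (degree (edge_rel ((q, p) |: E)) v <= degree (edge_rel E) v + ((v == q) + (v == p)))%N.
Proof.
have sub : [set u | edge_rel ((q, p) |: E) v u] \subset
    [set u | edge_rel E v u] :|:
      ([set u | (v == q) && (u == p)] :|: [set u | (v == p) && (u == q)]).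
  apply/subsetP => u; rewrite !inE /edge_rel /= !inE !xpair_eqE.
  by rewrite (andbC (u == q)) => /orP[/orP[->|->]|/orP[->|->]]; rewrite ?orbT.
have bnd (b : bool) w : (#|[set u | b && (u == w)]| <= b)%N.
  case: b => /=; first by rewrite -(cards1 w) subset_leq_card //; apply/subsetP => u; rewrite !inE.
  by rewrite leqn0 cards_eq0; apply/eqP/setP => u; rewrite !inE.
apply: leq_trans (subset_leq_card sub) _.
apply: leq_trans (leq_card_setU _ _) _; rewrite leq_add2l.
by apply: leq_trans (leq_card_setU _ _) _; apply: leq_add; apply: bnd.
Qed.

Lemma within_add E q p : within E -> e q p -> within ((q, p) |: E).
Proof. by move=> wE qp x y; rewrite !inE => /orP[/eqP[-> ->]|/wE]. Qed.

Lemma con_add E q p : con ((q, p) |: E) q p.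
Proof. by apply: connect1; rewrite /joined /edge_rel /= setU11 orbT. Qed.

(* The edges added along the path leave every class once, at the last vertex
   of the path in that class. A vertex at which a class is entered gains the
   ancestor [nd l], and a vertex at which a class is left gains [nd y] once the
   path has reached the class of [y]. *)
Lemma join_along_path l y E O q s :
  within E -> charged E O ->
  desc H0 (nd l) (nd y) -> ~~ con E l y ->
  (forall v, v \in O -> desc_eq H0 (nd v) (nd l) /\ con E l v) ->
  (forall v, v \in q :: s -> desc_eq H0 (nd v) (nd l) /\ v \notin O) ->
  path e q s -> con E l q -> con E (last q s) y ->
  exists E', [/\ E \subset E', within E', charged E' set0 & con E' l y].
Proof.
move: {2}(size s) (leqnn (size s)) => n.
elim: n E O q s => [|n IHn] E O q s szs wE chE ly nly inO inqs pth lq sy.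
  by case: s {inqs pth} szs sy => //= _ /(connect_trans lq); rewrite (negPf nly).
have nls : ~~ con E l (last q s) by apply: contra nly => ls; apply: connect_trans sy.
have hasl : has (con E l) (q :: s) by rewrite /= lq.
have [a [b [s' [la ain ab pth' [nl sub lst sz]]]]] := path_last_exit pth hasl nls.
have /allP/= nlb := nl.
have lb : ~~ con E l b by apply: nlb; apply: mem_head.
have [aW aO] := inqs a ain.
have bin u : u \in b :: s' -> u \in q :: s by move=> /sub us; rewrite inE us orbT.
have [bW bO] := inqs b (bin b (mem_head _ _)).
set E1 := (a, b) |: E.
have sE1 : E \subset E1 by apply: subsetUr.
have wE1 : within E1 by apply: within_add.
have la1 : con E1 l a by apply: joined_mono la.
have lb1 : con E1 l b by apply: connect_trans la1 (con_add _ _ _).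
have b_a : (b == a) = false by apply: contraNF lb => /eqP->.
(* Once [l] and [y] are connected, this pays for the edges by which classes were left: those at [a]
   and at the vertices of [O]. *)
have gain_y v : con E l v -> desc_eq H0 (nd v) (nd l) -> con E1 l y ->
    (#|joined_ancestors E v| < #|joined_ancestors E1 v|)%N.
  move=> lv vl ly1; apply: (joined_ancestors_gain sE1 (y := y)).
  - exact: desc_eq_desc ly.
  - by apply: connect_trans ly1; rewrite joined_csym; apply: joined_mono lv.
  - by apply: contra nly; apply: connect_trans.
(* The edge entering at [b] is paid for at once by [nd l], which is strictly above [nd b] because
   [b] was not connected to [l]. *)
have gain_b : (#|joined_ancestors E b| < #|joined_ancestors E1 b|)%N.
  apply: (joined_ancestors_gain sE1 (y := l)).
  - case: (desc_eqVdesc bW) => // ebl; case/negP: lb.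
    by apply: joined_node.
  - by rewrite joined_csym.
  - by rewrite joined_csym.
have mono v := subset_leq_card (joined_ancestors_mono v sE1).
have [ly1|nly1] := boolP (con E1 l y).
  exists E1; split=> // v vS; rewrite inE addn0.
  apply: leq_trans (degree_add _ _ _ _) _.
  apply: leq_trans (leq_add (chE v vS) (leqnn _)) _.
  have [->|v_a] := eqVneq v a.
    rewrite (negPf aO) eq_sym b_a addn0 /= addn1.
    exact: gain_y.
  have [->|v_b] := eqVneq v b; first by rewrite (negPf bO) addn0 addn1.
  rewrite addn0; have [/inO[vW lv]|_] := boolP (v \in O); last by rewrite addn0.
  by rewrite addn1; apply: gain_y.
(* Otherwise [a] goes into debt and the walk resumes at [b]; the remaining path avoids the old class
   of [l], hence also [a]. *)
have [|||||||E' [sE' wE' chE' ly']] := IHn E1 (a |: O) b s' _ wE1 _ ly nly1.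
- by rewrite -ltnS; apply: leq_trans sz szs.
- move=> v vS; apply: leq_trans (degree_add _ _ _ _) _.
  apply: leq_trans (leq_add (chE v vS) (leqnn _)) _; rewrite !inE.
  have [->|v_a] := eqVneq v a.
    by rewrite (negPf aO) eq_sym b_a !addn0 /= leq_add2r.
  have [->|v_b] := eqVneq v b; first by rewrite (negPf bO) !addn0 addn1.
  by rewrite addn0 leq_add2r.
- move=> v; rewrite !inE => /orP[/eqP->|/inO[vW lv]]; first by [].
  by split=> //; apply: joined_mono lv.
- move=> v vin; have [vW vO] := inqs v (bin v vin); split=> //.
  rewrite !inE negb_or vO andbT; apply: contraTneq la => <-.
  exact: nlb.
- by [].
- by [].
- by rewrite lst; apply: joined_mono sy.
by exists E'; split=> //; apply: subset_trans sE'.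
Qed.

Lemma joining_edges_exist : exists E : {set V * V},
  [/\ within E,
      forall v, v \notin S ->
        (degree (edge_rel E) v <= #|[set g in nodes H0 | desc H0 (nd v) g]|)%N,
      forall x y z, con E x z ->
        desc_eq H0 (nd x) (nd y) -> desc_eq H0 (nd y) (nd z) -> con E x y
    & forall a b, e a b -> b \in S -> desc H0 (nd a) (nd b) -> con E a b].
Proof.
pose ok E := [forall x, forall y, ((x, y) \in E) ==> e x y] &&
  [forall v, (v \notin S) ==> (degree (edge_rel E) v <= #|joined_ancestors E v|)%N].
have okP E : reflect (within E /\ charged E set0) (ok E).
  apply: (iffP andP) => -[h1 h2]; split.
  - by move=> x y; apply/implyP/(forallP (forallP h1 x)).
  - by move=> v vS; rewrite inE addn0; apply: (implyP (forallP h2 v)).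
  - by apply/'forall_forallP => x y; apply/implyP/h1.
  - by apply/forallP => v; apply/implyP => /h2; rewrite inE addn0.
have ok0 : ok set0.
  apply/okP; split=> [x y|v _]; first by rewrite inE.
  rewrite /degree (_ : [set u | _] = set0) ?cards0 //.
  by apply/setP => u; rewrite inE /edge_rel /= !inE.
pose size_con E := #|[set p | con E p.1 p.2]|.
case: (arg_maxnP size_con ok0) => E /okP[wE chE] maxE.
(* By maximality, no admissible enlargement of [E] connects a new pair. *)
have stuck E' x y : E \subset E' -> within E' -> charged E' set0 -> con E' x y -> con E x y.
  move=> sub wE' chE' xy'; have /maxE : ok E' by apply/okP.
  rewrite /= /size_con => le; apply: contraTT le => nxy; rewrite -ltnNge.
  apply: proper_card; apply/properP; split.
    by apply/subsetP => p; rewrite !inE; apply: joined_mono.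
  by exists (x, y); rewrite inE.
exists E; split=> //.
- move=> v vS; have := chE v vS; rewrite inE addn0 => /leq_trans; apply.
  apply: subset_leq_card; apply/subsetP => g /imsetP[y]; rewrite !inE => /andP[vy _] ->.
  by rewrite nd_nodes.
- move=> x l y xy xl ly.
  case: (desc_eqVdesc xl) => [/joined_node//|_].
  case: (desc_eqVdesc ly) => [/joined_node ely|{}ly].
    by apply: connect_trans xy _; rewrite joined_csym.
  apply: contraTT isT => nxl.
  have nly : ~~ con E l y.
    by apply: contra nxl => ly'; apply: connect_trans xy _; rewrite joined_csym.
  have [_ /(_ l x)] := connH0 (nd_nodes hH0 l).
  rewrite /= !in_Vsub // /desc_eq connect0 => /(_ isT xl)/connectP[s pth lst].
  have all_s : all [in Vsub H0 (nd l)] s.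
    elim: s l {xl ly nxl nly} (nd l) pth {lst} => //= b s IHs q g /andP[/and3P[_ -> _]].
    exact: IHs.
  have pth' : path e l s by apply: sub_path pth => a b /and3P[].
  have [|||||||E' [sE' wE' chE' ly']] := join_along_path (l := l) (y := y) (q := l) (s := s) wE chE.
  + by [].
  + by [].
  + by move=> v; rewrite inE.
  + move=> v vin; rewrite inE; split=> //; move: vin; rewrite inE.
    by case/orP => [/eqP->|/(allP all_s)]; [apply: connect0 | rewrite /= in_Vsub].
  + by [].
  + exact: connect0.
  + by rewrite -lst.
  by case/negP: nly; apply: stuck ly'.
- move=> a b ab bS desc_ab; apply: contraTT isT => nab.
  have sE1 : E \subset (a, b) |: E by apply: subsetUr.
  case/negP: (nab); apply: (stuck _ _ _ sE1); last exact: con_add.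
    exact: within_add.
  move=> v vS; rewrite inE addn0; apply: leq_trans (degree_add _ _ _ _) _.
  apply: leq_trans (leq_add (chE v vS) (leqnn _)) _; rewrite inE addn0.
  (* As [b] is in [S], only the degree at [a] must be paid for, and [a] gains the ancestor
     [nd b]. *)
  have v_b : (v == b) = false by apply: contraNF vS => /eqP->.
  rewrite v_b addn0; have [->|_] := eqVneq v a.
    by rewrite addn1; apply: (joined_ancestors_gain sE1 desc_ab (con_add _ _ _)).
  by rewrite addn0; apply/subset_leq_card/joined_ancestors_mono.
Qed.

End Growth.

(** * The colouring and the final assembly *)

Lemma trunc_log_le_log2 (R : realType) (n : nat) : (0 < n)%N ->
  (trunc_log 2 n)%:R <= log2 R n.
Proof.
move=> n0; rewrite /log2 ler_pdivlMr; last by rewrite ln_gt0 // ltr1n.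
rewrite mulr_natl -lnXn ?ltr0n // -natrX ler_ln ?posrE ?ltr0n ?expn_gt0 //.
by rewrite ler_nat trunc_logP.
Qed.

Lemma separating_colouring (V : finType) (A : {set {set V}}) (f : nat) :
  (0 < f)%N -> (#|A| <= #|V|)%N -> (forall X, X \in A -> (#|X| < #|V|)%N) ->
  exists c : V -> 'I_f.+1, forall X k, X \in A ->
    (forall v, v \in X -> c v != k) -> (#|X| <= f * (4 * trunc_log 2 #|V|))%N.
Proof.
move=> f0 cardA sizeA; set l := trunc_log 2 _.
have [V1|V1] := leqP #|V| 1.
  exists (fun=> ord0) => X k /sizeA /leq_trans/(_ V1) X1 _.
  by move: X1; rewrite ltnS leqn0 => /eqP->.
have l0 : (0 < l)%N by rewrite trunc_log_gt0.
(* If there are at most [f] vertices, every set of [A] is already small enough and any colouring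
   will do. *)
have [Vf|fV] := leqP #|V| f.
  exists (fun=> ord0) => X k /sizeA/ltnW X1 _; apply: leq_trans X1 (leq_trans Vf _).
  by rewrite leq_pmulr // muln_gt0.
(* With exponent [2(l+1)], [2^(2(l+1))] exceeds [|V|^2], which bounds the number of pairs as
   [f+1 <= |V|]. Since [l >= 1], [2(l+1) <= 4l]. *)
pose B := [set X in A | f * (l.+1 * 2) <= #|X|]%N.
have ltV : (#|V| < 2 ^ l.+1)%N by apply: trunc_log_ltn.
have ltB : (#|B| * f.+1 < 2 ^ (l.+1 * 2))%N.
  apply: (@leq_ltn_trans (#|V| * #|V|)).
    apply: leq_mul => //; apply: leq_trans cardA.
    by apply: subset_leq_card; apply/subsetP => X; rewrite inE => /andP[].
  by rewrite expnM -mulnn ltn_mul.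
have sizeB X : X \in B -> (f * (l.+1 * 2) <= #|X|)%N by rewrite inE => /andP[].
have [c cP] := hitting_colouring f0 ltB sizeB.
exists c => X k XA nk; rewrite leqNgt; apply/negP => ltX.
have XB : X \in B.
  rewrite inE XA; apply: leq_trans (ltnW ltX); rewrite leq_pmul2l //.
  by rewrite mulSn -[4%N]/(2 + 2)%N mulnDl (mulnC l) leq_add2r leq_pmulr.
by have [v vX /eqP] := cP X k XB; apply/negP/nk.
Qed.

Lemma connect_induced_class (V : finType) (F : rel V) (K : {set V}) x y :
  (forall u v, u \in K -> F u v -> v \in K) -> x \in K -> connect F x y ->
  connect (adj (induced F K)) x y.
Proof.
move=> closedK xK /connectP[p]; elim: p x xK => [|z p IHp] x xK /=.
  by move=> _ ->; apply: connect0.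
move=> /andP[xz pth ly]; have zK := closedK _ _ xK xz.
apply: connect_trans (IHp z zK pth ly); apply: connect1.
by rewrite /= xK zK.
Qed.

Theorem theorem3p2 (R : realType) :
  exists C : R,
  forall (V : finType) (e : rel V) (H0 : rtree {set V}) (f : nat),
    simple_graph (Graph [set: V] e) ->
    connected_graph (Graph [set: V] e) ->
    base_hierarchy R e H0 ->
    (1 <= f)%N ->
    exists S : 'I_f.+1 -> {set V},
      [/\ \bigcup_(i < f.+1) S i = [set: V],
          forall i j : 'I_f.+1, i != j -> [disjoint S i & S j]
        & forall i : 'I_f.+1,
            exists H : rtree {set V},
              [/\ hierarchy H,
                  [/\ coarsening H0 H, log_height R H,
                      edges_comparable e H & subtrees_connected e H],
                  forall K, K \in nodes H ->
                    exists T : graph V,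
                      spanning_tree_in e T K /\
                      (forall v, v \in K :\: S i ->
                         (degree (adj T) v)%:R <= 3%:R * log2 R #|V|)
                & forall K, K \in nodes H ->
                    #|Nsub e H K|%:R <= C * f%:R * log2 R #|V|]].
Proof.
exists 4%:R => V e H0 f [symE irrE _] [V0 _] [hH0 logH0 cmpH0 subH0 [T0 [T0P degTU]]] f0.
rewrite /= in symE irrE V0; have rt0 := hH0.2; have [connH0 _] := subH0.
pose nd := pblock (nodes H0).
(* Only neighbourhoods of subtrees of [H0] occur, so the colouring can be fixed before any
   contraction is built. *)
pose A := [set Nsub e H0 (nd v) | v : V].
have cardA : (#|A| <= #|V|)%N by apply: leq_imset_card.
have sizeA X : X \in A -> (#|X| < #|V|)%N.
  move=> /imsetP[x _ ->]; rewrite -cardsT; apply: proper_card; apply/properP.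
  split; first exact: subsetT.
  by exists x; rewrite // !inE in_Vsub // /desc_eq connect0.
have [c cP] := separating_colouring f0 cardA sizeA.
exists (fun i => [set v | c v == i]); split.
- by apply/setP => v; rewrite inE; apply/bigcupP; exists (c v); rewrite ?inE.
- move=> i j; apply: contraNT => /pred0Pn[v /andP[]] /=.
  by rewrite !inE => /eqP-> /eqP->.
move=> i; set S := [set v | _].
set TU : rel V := [rel u v | [exists g in nodes H0, adj (T0 g) u v]] in degTU.
have symTU : symmetric TU.
  by move=> x y; apply/exists_inP/exists_inP => -[g gH];
    have [_ [[sym _ _] _ _] _ _] := T0P g gH; exists g; rewrite // sym.
have subTU : subrel TU e.
  by move=> x y /exists_inP[g gH]; have [[_ _ sub] _ _ _] := T0P g gH; apply: sub.
have nodeTU x y : nd x = nd y -> connect TU x y.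
  move=> exy; have gH : nd x \in nodes H0 by apply: nd_nodes.
  have [_ [_ [_ conT] _] /subsetP sub _] := T0P _ gH.
  have xT : x \in vset (T0 (nd x)) by apply/sub/mem_nd.
  have yT : y \in vset (T0 (nd x)) by rewrite exy in sub *; apply/sub/mem_nd.
  apply: connect_sub (conT x y xT yT) => a b ab; apply: connect1.
  by apply/exists_inP; exists (nd x).
have [E [wE degE convE stepE]] := joining_edges_exist S hH0 connH0 symTU nodeTU.
set F := joined TU E in convE stepE.
have symF : symmetric F by apply: joined_sym.
have subF : subrel F e.
  by move=> x y /or3P[/subTU|/wE|/wE]; rewrite // symE.
have nodeF x y : nd x = nd y -> connect F x y by apply: joined_node.
have irrF : irreflexive F by move=> x; apply/negP => /subF; rewrite irrE.
have csF : connect_sym F by apply: sym_connect_sym.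
exists (contraction H0 F); split.
- exact: (contraction_hierarchy hH0 cmpH0 symF subF nodeF convE).
- split.
  + exact: (contraction_coarsening hH0 cmpH0 symF subF nodeF convE).
  + apply: le_trans logH0; rewrite ler_nat.
    exact: (contraction_height hH0 cmpH0 symF subF nodeF convE).
  + exact: (contraction_edges_comparable hH0 cmpH0 symF subF nodeF convE).
  + exact: (contraction_subtrees_connected hH0 cmpH0 symF subF nodeF convE subH0).
- move=> K /imsetP[t _ ->].
  have connK : connected_graph (induced F (class_of F t)).
    split=> [|x y]; first by apply/set0Pn; exists t; apply: mem_class.
    rewrite /= => xK; have := xK; rewrite !inE => tx ty.
    apply: connect_induced_class => // [u v|]; last by apply: connect_trans ty; rewrite csF.
    by rewrite !inE => tu uv; apply: connect_trans tu (connect1 uv).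
  have [T [simT subT relT] [treeT vT]] := spanning_tree_exists symF irrF connK.
  exists T; split.
    split=> //; split=> // x y /relT /and3P[xK yK /subF exy].
    by rewrite /= xK yK.
  move=> v /setDP[vK vS].
  (* The bound 3 log n splits as 2 log n from the Steiner trees and log n, the height, from [E]. *)
  have degT : (degree (adj T) v <= degree TU v + degree (edge_rel E) v)%N.
    apply: leq_trans (leq_card_setU _ _); apply: subset_leq_card.
    by apply/subsetP => u; rewrite !inE => /relT/and3P[_ _].
  have degEv : (degree (edge_rel E) v <= height H0)%N.
    apply: leq_trans (degE v vS) _.
    exact: (@leq_bigmax_cond _ [in nodes H0] _ (nd v) (nd_nodes hH0 v)).
  apply: (@le_trans _ _ (degree TU v + height H0)%:R).
    by rewrite ler_nat; apply: leq_trans degT _; rewrite leq_add2l.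
  by rewrite natrD -(natr1 2) mulrDl mul1r lerD.
move=> K /(contraction_Vsub hH0 cmpH0 symF subF nodeF convE)[t [_ topt eVsub]].
have -> : Nsub e (contraction H0 F) K = Nsub e H0 (nd t) by rewrite /Nsub eVsub.
have sizeN : (#|Nsub e H0 (nd t)| <= f * (4 * trunc_log 2 #|V|))%N.
  apply: (cP _ i); first exact: imset_f.
  move=> v; rewrite inE in_Vsub // => /andP[nvt /exists_inP[u]].
  rewrite in_Vsub // => ut uv; apply: contraNneq nvt => cvi.
  (* Suppose a neighbour [v] of colour [i] is above [u] and [t]. Then [u] and [v] are [F]-connected,
     convexity adds [t], and [v] falls into the class of [t], hence below its top. *)
  case/orP: (edge_comparable cmpH0 uv) => [le_uv|vu]; last exact: connect_trans vu ut.
  case/orP: (desc_eq_total rt0 ut le_uv) => // tv.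
  apply: topt; have [uv'|uv'] := desc_eqVdesc le_uv.
    by apply/nodeF/(desc_eq_anti rt0 tv); move: ut; rewrite /nd uv'.
  have Fuv : connect F u v by apply: stepE => //; rewrite inE cvi.
  by apply: (connect_trans _ Fuv); rewrite csF; apply: convE Fuv ut tv.
have V1 : (0 < #|V|)%N by rewrite -cardsT card_gt0.
apply: (@le_trans _ _ (f * (4 * trunc_log 2 #|V|))%:R); first by rewrite ler_nat.
rewrite !natrM mulrCA -mulrA ler_wpM2l // ler_wpM2l // trunc_log_le_log2 //.
Qed.
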